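(* Let $A=\begin{bmatrix}A_{11}&A_{21}^H\\ A_{21}&A_{22}\end{bmatrix}$ and $E=\begin{bmatrix}E_{11}&E_{21}^H\\ E_{21}&E_{22}\end{bmatrix}$ be Hermitian matrices of the same size, partitioned conformally, with square Hermitian diagonal blocks. For each $i$ let $\lambda_i$ and $\widehat\lambda_i$ be the $i$th smallest eigenvalue (counted with multiplicity) of $A$ and of $A+E$ respectively, and define $$\tau_i=\frac{\|A_{21}\|_2+\|E_{21}\|_2}{\min_j|\lambda_i-\lambda_j(A_{22})|-2\|E\|_2}.$$ For each $i$, if $\tau_i>0$ then $$|\lambda_i-\widehat\lambda_i|\le \|E_{11}\|_2+2\|E_{21}\|_2\,\tau_i+\|E_{22}\|_2\,\tau_i^2.$$
   Context: $\|\cdot\|_2$ denotes the spectral norm. For a Hermitian matrix $X$, $\lambda_j(X)$ denotes the $j$th smallest eigenvalue of $X$ counted with multiplicity; the minimum over $j$ runs over all eigenvalues of $A_{22}$. $M^H$ denotes the conjugate transpose. The eigenvalues of $A+tE$, $t\in[0,1]$, are not required to be simple. The condition $\tau_i>0$ presupposes that the denominator defining $\tau_i$ is nonzero. *)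

(* Defs.v *)
From HB Require Import structures.
From mathcomp Require Import all_boot all_order all_algebra.
From mathcomp Require Import boolp classical_sets reals.
From mathcomp Require Export complex.

Set Implicit Arguments.
Unset Strict Implicit.
Unset Printing Implicit Defensive.

Import Order.TTheory GRing.Theory Num.Theory.
Local Open Scope ring_scope.
Local Open Scope sesquilinear_scope.
Local Open Scope complex_scope.
Local Open Scope classical_set_scope.

Section Definitions.
Context {R : realType}.

Definition norm2 n (x : 'cV[R[i]]_n) : R :=
  Num.sqrt (\sum_(k < n) ComplexField.Normc.normc (x k 0) ^+ 2).

(* The unit ball rather than the unit sphere: the set is then nonempty also
   when [n = 0]. *)
Definition specnorm m n (M : 'M[R[i]]_(m, n)) : R :=
  sup [set norm2 (M *m x) | x in [set x : 'cV[R[i]]_n | norm2 x <= 1]].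

(* The roots of the characteristic polynomial, with multiplicity; taking real
   parts loses nothing for Hermitian [X] (lemma [eigenvalsP] below). *)
Definition eigenvals n (X : 'M[R[i]]_n) : seq R :=
  sort <=%R
    [seq complex.Re z | z <- sval (closed_field_poly_normal (char_poly X))].

(* Indices start at 0: [eigenval X i] is the [i.+1]-th smallest eigenvalue. *)
Definition eigenval n (X : 'M[R[i]]_n) (i : 'I_n) : R := (eigenvals X)`_i.

(* The default value is one of the terms, so this is a plain minimum. *)
Definition spectrum_dist n (X : 'M[R[i]]_n.+1) (a : R) : R :=
  \big[Order.min/`|a - eigenval X ord0|]_(j < n.+1) `|a - eigenval X j|.

Lemma size_eigenvals n (X : 'M[R[i]]_n) : size (eigenvals X) = n.
Proof.
rewrite size_sort size_map; case: closed_field_poly_normal => s /= Xs.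
have /eqP : size (char_poly X) = n.+1 by rewrite size_char_poly.
by rewrite Xs (monicP (char_poly_monic X)) scale1r size_prod_XsubC => /eqP[].
Qed.

Lemma root_char_poly_herm n (X : 'M[R[i]]_n) (z : R[i]) :
  X \is hermsymmx -> root (char_poly X) z -> z \is Num.real.
Proof.
move=> /is_hermitianmxP; rewrite expr0 scale1r => XH.
rewrite -eigenvalue_root_char => /eigenvalueP[v vX v0].
have d0 : (v *m v^t*) 0 0 != 0.
  by rewrite -dotmxE lt0r_neq0// dnorm_gt0.
apply/CrealP/(mulIf d0).
have e1 : v *m X *m v^t* = z *: (v *m v^t*) by rewrite vX scalemxAl.
have e2 : (v *m X *m v^t*)^t* = v *m X *m v^t*.
  by rewrite !trmx_mul !map_mxM trmxCK -XH mulmxA.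
have e3 : (v *m v^t*)^t* = v *m v^t* by rewrite trmx_mul map_mxM trmxCK.
have cE (w : 'M[R[i]]_1) : w^t* 0 0 = (w 0 0)^*%R by rewrite !mxE.
rewrite -{1}e3 cE -rmorphM; move: e2; rewrite e1 => /matrixP/(_ 0 0).
by rewrite cE mxE.
Qed.

Lemma eigenvalsP n (X : 'M[R[i]]_n) : X \is hermsymmx ->
  char_poly X = \prod_(a <- eigenvals X) ('X - (a%:C)%:P).
Proof.
move=> XH; rewrite /eigenvals; case: closed_field_poly_normal => s /= Xs.
rewrite (perm_big _ (permEl (perm_sort _ _)))/= big_map Xs.
rewrite (monicP (char_poly_monic X)) scale1r; apply: eq_big_seq => z zs.
have /(root_char_poly_herm XH)/Creal_ReP : root (char_poly X) z.
  by rewrite Xs rootZ ?root_prod_XsubC// (monicP (char_poly_monic X)) oner_neq0.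
by rewrite -complexRe => ->.
Qed.

Lemma specnorm_has_sup m n (M : 'M[R[i]]_(m, n)) :
  has_sup [set norm2 (M *m x) | x in [set x : 'cV[R[i]]_n | norm2 x <= 1]].
Proof.
split.
  exists (norm2 (M *m 0)), 0 => //=; rewrite /norm2 big1 ?sqrtr0// => k _.
  by rewrite mxE ComplexField.Normc.normc0 expr0n.
exists (Num.sqrt (\sum_(k < m)
  (\sum_(l < n) ComplexField.Normc.normc (M k l)) ^+ 2)) => _ [x /= x1 <-].
have n0 z : 0 <= ComplexField.Normc.normc z :> R.
  by case: z => a b; exact: sqrtr_ge0.
have nD (s : seq 'I_n) (F : 'I_n -> R[i]) :
    ComplexField.Normc.normc (\sum_(l <- s) F l) <=
    \sum_(l <- s) ComplexField.Normc.normc (F l).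
  by have := ler_norm_sum s F predT;
    rewrite -[X in _ <= X -> _](rmorph_sum (real_complex R)) lecR.
have xl l : ComplexField.Normc.normc (x l 0) <= 1.
  rewrite -(@expr_le1 _ 2)//.
  move: x1; rewrite /norm2 -[X in _ <= X]sqrtr1 ler_sqrt// => x1.
  apply: le_trans x1.
  by rewrite (bigD1 l)//= lerDl sumr_ge0// => ? _; rewrite exprn_ge0.
rewrite /norm2 ler_wsqrtr//; apply: ler_sum => k _.
rewrite lerXn2r ?nnegrE ?n0 ?sumr_ge0// mxE.
apply: (le_trans (nD _ _)); apply: ler_sum => l _.
by rewrite ComplexField.Normc.normcM ler_piMr.
Qed.

End Definitions.

(* Main.v *)
(* For Hermitian [M(t) = A + tE] the [i]-th eigenvalue [l(t)] changes to first
   order by [x^H E x], [x] a unit eigenvector. At a multiple eigenvalue this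
   survives in a one-sided form: if [M(s) x = l(s) x] then
   [l(s) - l(t) - (s - t) x^H E x = x^H (M(t) - l(t)) x], which is quadratic in
   [s - t], because expanding [x] in eigenvectors of [M(t)] gives
   [|x^H (M(t) - l(t)) x| <= |(M(t) - l(t)) x|^2 / g], with [g] the distance
   from [l(t)] to the other eigenvalues. So [|l(1) - l(0)|] is at most any
   uniform bound on [|x^H E x|] along the path. By the second block row of
   [M(t) x = l(t) x], the lower block of [x] has norm at most [tau], and this
   yields such a bound. *)
Require Import Defs.
From mathcomp Require Import all_boot all_order all_algebra reals.
From mathcomp Require Import perm ring lra.
Import Order.TTheory GRing.Theory Num.Theory.
Local Open Scope ring_scope.
Local Open Scope sesquilinear_scope.

Set Implicit Arguments.
Unset Strict Implicit.
Unset Printing Implicit Defensive.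

Section HermitianPerturbation.
Context {R : realType}.

(** * Real inner product, Euclidean norm and spectral norm *)

(* The real part of the Hermitian product; it suffices because all the
   eigenvalues that occur as scalars are real. *)
Definition rdot n (x y : 'cV[R[i]]_n) : R := complex.Re ((x^t* *m y) 0 0).

Lemma rdotE n (x y : 'cV[R[i]]_n) : rdot x y = \sum_k
  (complex.Re (x k 0) * complex.Re (y k 0)
   + complex.Im (x k 0) * complex.Im (y k 0)).
Proof.
rewrite /rdot mxE raddf_sum; apply: eq_bigr => k _; rewrite !mxE.
by case: (x k 0) => a b; case: (y k 0) => c d /=; rewrite mulNr opprK.
Qed.

Lemma rdotC n (x y : 'cV[R[i]]_n) : rdot x y = rdot y x.
Proof.
by rewrite !rdotE; apply: eq_bigr => k _; rewrite mulrC [X in _ + X]mulrC.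
Qed.

Lemma rdot0r n (x : 'cV[R[i]]_n) : rdot x 0 = 0.
Proof. by rewrite /rdot mulmx0 mxE. Qed.

Lemma rdotDr n (x y z : 'cV[R[i]]_n) : rdot x (y + z) = rdot x y + rdot x z.
Proof. by rewrite /rdot mulmxDr mxE raddfD. Qed.

Lemma rdotNr n (x y : 'cV[R[i]]_n) : rdot x (- y) = - rdot x y.
Proof. by rewrite /rdot mulmxN mxE raddfN. Qed.

Lemma rdotBr n (x y z : 'cV[R[i]]_n) : rdot x (y - z) = rdot x y - rdot x z.
Proof. by rewrite rdotDr rdotNr. Qed.

Lemma rdotZr n (a : R) (x y : 'cV[R[i]]_n) :
  rdot x (a%:C%C *: y) = a * rdot x y.
Proof.
rewrite !rdotE mulr_sumr; apply: eq_bigr => k _; rewrite mxE.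
by case: (x k 0) (y k 0) => p q [r s] /=; ring.
Qed.

Lemma rdot_adjoint m n (M : 'M[R[i]]_(m, n)) x y :
  rdot (M^t* *m x) y = rdot x (M *m y).
Proof. by rewrite /rdot trmx_mul map_mxM trmxCK mulmxA. Qed.

Lemma norm2_ge0 n (x : 'cV[R[i]]_n) : 0 <= norm2 x.
Proof. exact: sqrtr_ge0. Qed.

Lemma norm2_sqr n (x : 'cV[R[i]]_n) : norm2 x ^+ 2 = rdot x x.
Proof.
rewrite sqr_sqrtr; last by apply: sumr_ge0 => k _; exact: sqr_ge0.
rewrite rdotE; apply: eq_bigr => k _; case: (x k 0) => a b /=.
by rewrite sqr_sqrtr ?addr_ge0 ?sqr_ge0.
Qed.

Lemma norm2_0 n : norm2 (0 : 'cV[R[i]]_n) = 0.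
Proof. by apply/eqP; rewrite -sqrf_eq0 norm2_sqr rdot0r. Qed.

Lemma norm2_eq0 n (x : 'cV[R[i]]_n) : norm2 x = 0 -> x = 0.
Proof.
move=> x0; apply/matrixP => k j; rewrite (ord1 j) mxE.
move: (norm2_sqr x); rewrite x0 expr0n rdotE => /esym/eqP.
rewrite psumr_eq0 => [/allP/(_ k)|l _]; last first.
  by rewrite addr_ge0 // -expr2 sqr_ge0.
rewrite mem_index_enum => /(_ isT) /=.
case: (x k 0) => a b /=; rewrite paddr_eq0 -?expr2 ?sqr_ge0//.
by rewrite !sqrf_eq0 => /andP[/eqP-> /eqP->].
Qed.

Lemma norm2_gt0 n (x : 'cV[R[i]]_n) : x != 0 -> 0 < norm2 x.
Proof.
move=> x0; rewrite lt0r norm2_ge0 andbT.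
by apply: contra x0 => /eqP/norm2_eq0->.
Qed.

Lemma norm2Z n (a : R) (x : 'cV[R[i]]_n) :
  norm2 (a%:C%C *: x) = `|a| * norm2 x.
Proof.
apply/eqP; rewrite -(@eqrXn2 _ 2) ?norm2_ge0 ?mulr_ge0 ?norm2_ge0//.
rewrite exprMn !norm2_sqr rdotZr rdotC rdotZr -normrX.
by rewrite ger0_norm ?sqr_ge0// mulrA.
Qed.

Lemma norm2N n (x : 'cV[R[i]]_n) : norm2 (- x) = norm2 x.
Proof. by have := norm2Z (-1) x; rewrite rmorphN1 scaleN1r normrN1 mul1r. Qed.

Lemma rdot_le n (x y : 'cV[R[i]]_n) : `|rdot x y| <= norm2 x * norm2 y.
Proof.
have key (u v : 'cV[R[i]]_n) : rdot u v <= norm2 u * norm2 v.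
  have [->|/norm2_gt0 u0] := eqVneq u 0.
    by rewrite rdotC rdot0r norm2_0 mul0r.
  have [->|/norm2_gt0 v0] := eqVneq v 0.
    by rewrite rdot0r norm2_0 mulr0.
  (* Cauchy-Schwarz: this square equals [2 * norm2 u * norm2 v * (norm2 u * norm2 v - rdot u v)]. *)
  have := sqr_ge0 (norm2 ((norm2 v)%:C%C *: u - (norm2 u)%:C%C *: v)).
  rewrite norm2_sqr rdotBr !rdotZr ![rdot (_ - _) _]rdotC !rdotBr !rdotZr.
  rewrite -!norm2_sqr (rdotC v u).
  have uv0 : 0 < norm2 u * norm2 v by rewrite mulr_gt0.
  move=> h; rewrite -subr_ge0 -(pmulr_rge0 (_ - _) uv0); nra.
rewrite ler_norml key andbT lerNl -rdotNr; apply: le_trans (key _ _) _.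
by rewrite norm2N.
Qed.

Lemma norm2D n (x y : 'cV[R[i]]_n) : norm2 (x + y) <= norm2 x + norm2 y.
Proof.
rewrite -(@ler_pXn2r _ 2) ?nnegrE ?addr_ge0 ?norm2_ge0// norm2_sqr.
rewrite rdotDr ![rdot (_ + _) _]rdotC !rdotDr -!norm2_sqr (rdotC y x).
have := ler_norml (rdot x y) (norm2 x * norm2 y); rewrite rdot_le.
by move=> /esym/andP[_ h]; nra.
Qed.

Lemma norm2B n (x y : 'cV[R[i]]_n) : norm2 (x - y) <= norm2 x + norm2 y.
Proof. by rewrite -(norm2N y) norm2D. Qed.

Lemma specnorm_ge0 m n (M : 'M[R[i]]_(m, n)) : 0 <= specnorm M.
Proof.
have [_ ub] := specnorm_has_sup M.
apply: le_trans (norm2_ge0 (M *m 0)) _; apply: ub_le_sup => //.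
by exists 0 => //=; rewrite norm2_0.
Qed.

Lemma specnormP m n (M : 'M[R[i]]_(m, n)) x :
  norm2 (M *m x) <= specnorm M * norm2 x.
Proof.
have [->|x0] := eqVneq x 0.
  by rewrite mulmx0 !norm2_0 mulr0.
have {}x0 := norm2_gt0 x0.
have [y y1 xE] : exists2 y, norm2 y = 1 & x = (norm2 x)%:C%C *: y.
  exists (((norm2 x)^-1)%:C%C *: x); last first.
    by rewrite scalerA -rmorphM mulfV ?gt_eqF// rmorph1 scale1r.
  by rewrite norm2Z gtr0_norm ?invr_gt0// mulVf ?gt_eqF.
rewrite {1}xE -scalemxAr norm2Z gtr0_norm// mulrC ler_pM2r//.
have [_ ub] := specnorm_has_sup M.
by apply: ub_le_sup => //; exists y => //=; rewrite y1.
Qed.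

(** * Unitary diagonalization and coordinates in an eigenbasis *)

Lemma hermP n (X : 'M[R[i]]_n) : X \is hermsymmx -> X^t* = X.
Proof. by move=> /is_hermitianmxP; rewrite expr0 scale1r => <-. Qed.

Lemma hermE n (X : 'M[R[i]]_n) : X^t* = X -> X \is hermsymmx.
Proof. by move=> h; apply/is_hermitianmxP; rewrite expr0 scale1r h. Qed.

(** Over the polynomial ring, an integral domain, both sides agree after multiplication by the
    nonzero constant [\det U]. *)
Lemma char_poly_conj n (U X Y : 'M[R[i]]_n) : U \in unitmx ->
  U *m X = Y *m U -> char_poly X = char_poly Y.
Proof.
move=> Uu UX; set V := map_mx polyC U.
have Vu : \det V != 0.
  by rewrite det_map_mx polyC_eq0; move: Uu; rewrite unitmxE unitfE.
apply/(mulfI Vu); rewrite /char_poly -det_mulmx [RHS]mulrC -det_mulmx.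
congr (\det _); rewrite /char_poly_mx mulmxBr mulmxBl -!map_mxM UX.
by rewrite scalar_mxC.
Qed.

(** The spectral theorem gives the eigenvalues in an unspecified order, whereas [eigenval] is
    sorted. Two factorizations of one characteristic polynomial differ by a permutation, which is
    then applied to the rows of the unitary matrix. *)
Lemma herm_diag n (X : 'M[R[i]]_n) : X \is hermsymmx ->
  exists2 U : 'M[R[i]]_n, U \is unitarymx &
    U *m X = diag_mx (\row_k (eigenval X k)%:C%C) *m U.
Proof.
move=> XH; set P := spectralmx X; set d := spectral_diag X.
have PU : P \is unitarymx := spectral_unitarymx X.
have Pu : P \in unitmx := spectral_unit X.
have PX : P *m X = diag_mx d *m P.
  have /hermitian_normalmx/orthomx_spectralP {1}-> := XH.
  by rewrite !mulmxA mulmxV// mul1mx.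
have : perm_eq [seq a%:C%C | a <- eigenvals X] [tuple d 0 k | k < n].
  apply: prod_XsubC_eq; rewrite big_map -eigenvalsP// (char_poly_conj Pu PX).
  rewrite char_poly_trig ?diag_mx_is_trig// big_tuple.
  by apply: eq_bigr => k _; rewrite tnth_mktuple !mxE eqxx.
move=> /tuple_permP[s es].
have ds k : d 0 (s k) = (eigenval X k)%:C%C.
  have := congr1 (fun l => nth 0 l k) es.
  rewrite (nth_map 0) ?size_eigenvals// => ->.
  by rewrite -tnth_nth !tnth_mktuple.
exists (row_perm s P).
  have rP k : row k (row_perm s P) = row (s k) P.
    by apply/rowP => j; rewrite !mxE.
  apply/row_unitarymxP => k l; rewrite !rP.
  by have /row_unitarymxP -> := PU; rewrite (inj_eq perm_inj).
apply/matrixP => k l; rewrite row_permE -mulmxA PX -!row_permE.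
by rewrite !mul_diag_mx !mxE -ds.
Qed.

(** When [U] diagonalizes [X], its rows are the conjugate transposes of an orthonormal eigenbasis,
    and this is the squared modulus of the [k]-th coordinate of [x] in that basis. *)
Definition weight n (U : 'M[R[i]]_n) (x : 'cV[R[i]]_n) (k : 'I_n) : R :=
  ComplexField.Normc.normc ((U *m x) k 0) ^+ 2.

Lemma weight_ge0 n (U : 'M[R[i]]_n) x k : 0 <= weight U x k.
Proof. exact: sqr_ge0. Qed.

Lemma unitary_rdot n (U : 'M[R[i]]_n) x y : U \is unitarymx ->
  rdot (U *m x) (U *m y) = rdot x y.
Proof.
move=> UU; have /unitarymxP : U^t* \is unitarymx by rewrite trmxC_unitary.
by rewrite trmxCK => UV; rewrite -rdot_adjoint mulmxA UV mul1mx.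
Qed.

Section Diagonalized.
Variables (n : nat) (X U : 'M[R[i]]_n) (d : 'I_n -> R).
Hypotheses (UU : U \is unitarymx)
  (UX : U *m X = diag_mx (\row_k (d k)%:C%C) *m U).

Lemma coord_shift (a : R) (x : 'cV[R[i]]_n) k :
  (U *m (X *m x - a%:C%C *: x)) k 0 = (d k - a)%:C%C * (U *m x) k 0.
Proof.
rewrite mulmxBr mulmxA UX -mulmxA -scalemxAr mul_diag_mx !mxE.
by rewrite rmorphB mulrBl.
Qed.

Lemma norm2_weight x : norm2 x ^+ 2 = \sum_k weight U x k.
Proof.
rewrite norm2_sqr -(unitary_rdot _ _ UU) -norm2_sqr sqr_sqrtr//.
by apply: sumr_ge0 => k _; exact: weight_ge0.
Qed.

Lemma norm2_shift (a : R) x :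
  norm2 (X *m x - a%:C%C *: x) ^+ 2 = \sum_k (d k - a) ^+ 2 * weight U x k.
Proof.
rewrite norm2_weight; apply: eq_bigr => k _; rewrite /weight coord_shift.
rewrite ComplexField.Normc.normcM exprMn; congr (_ * _).
by rewrite /= expr0n addr0 sqrtr_sqr -normrX ger0_norm ?sqr_ge0.
Qed.

Lemma rdot_shift (a : R) x :
  rdot x (X *m x - a%:C%C *: x) = \sum_k (d k - a) * weight U x k.
Proof.
rewrite -(unitary_rdot _ _ UU) rdotE; apply: eq_bigr => k _.
rewrite /weight coord_shift; case: ((U *m x) k 0) => p q /=.
by rewrite sqr_sqrtr ?addr_ge0 ?sqr_ge0//; ring.
Qed.

End Diagonalized.

(* The quadratic form of [X - a] only sees eigenvalues different from [a], so
   it is of second order in the residual. *)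
Lemma herm_rdot_shift_le n (X : 'M[R[i]]_n) (a : R) : X \is hermsymmx ->
  exists2 g : R, 0 < g & forall x,
    g * `|rdot x (X *m x - a%:C%C *: x)| <= norm2 (X *m x - a%:C%C *: x) ^+ 2.
Proof.
move=> /herm_diag[U UU UX]; pose d k := eigenval X k.
(* The default 1 keeps the gap positive when every eigenvalue equals [a]. *)
exists (\big[Order.min/1]_(k | d k != a) `|d k - a|).
  by apply: lt_bigmin => [|k]; rewrite ?ltr01// normr_gt0 subr_eq0.
move=> x; rewrite (norm2_shift UU UX) (rdot_shift UU UX).
apply: le_trans (ler_wpM2l _ (ler_norm_sum _ _ _)) _.
  by apply: le_bigmin => // k _; exact: normr_ge0.
rewrite mulr_sumr; apply: ler_sum => k _.
rewrite normrM [X in _ * (_ * X)]ger0_norm ?weight_ge0// mulrA.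
rewrite ler_wpM2r ?weight_ge0//.
have [->|dk] := eqVneq (eigenval X k) a.
  by rewrite subrr normr0 mulr0 expr0n.
rewrite -(@ger0_norm _ (_ ^+ 2)) ?sqr_ge0// normrX expr2 ler_wpM2r//.
exact: bigmin_le_cond.
Qed.

(** In an eigenbasis [X - a] scales each coordinate by a factor of modulus at least the distance
    from [a] to the spectrum. *)
Lemma norm2_shift_ge n (X : 'M[R[i]]_n.+1) (a : R) x : X \is hermsymmx ->
  0 <= spectrum_dist X a ->
  spectrum_dist X a * norm2 x <= norm2 (X *m x - a%:C%C *: x).
Proof.
move=> /herm_diag[U UU UX] s0.
rewrite -(@ler_pXn2r _ 2) ?nnegrE ?mulr_ge0 ?norm2_ge0//.
rewrite exprMn (norm2_shift UU UX) (norm2_weight UU) mulr_sumr.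
apply: ler_sum => k _; rewrite ler_wpM2r ?weight_ge0//.
rewrite -(@ger0_norm _ ((_ - _) ^+ 2)) ?sqr_ge0// normrX ler_pXn2r ?nnegrE//.
by rewrite distrC; exact: bigmin_le_cond.
Qed.

(** Column [i] of [U^t*] carries all its weight at index [i], so the weighted sums give norm 1 and
    residual 0. *)
Lemma eigenvec n (X : 'M[R[i]]_n) (i : 'I_n) : X \is hermsymmx ->
  exists2 x, norm2 x = 1 & X *m x = (eigenval X i)%:C%C *: x.
Proof.
move=> /herm_diag[U UU UX]; pose x := U^t* *m (delta_mx i 0 : 'cV[R[i]]_n).
have Ux : U *m x = delta_mx i 0.
  by rewrite mulmxA; move/unitarymxP: (UU) => ->; rewrite mul1mx.
have wx k : weight U x k = (k == i)%:R.
  rewrite /weight Ux mxE eqxx andbT; case: eqP => _.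
    by rewrite ComplexField.Normc.normc1 expr1n.
  by rewrite ComplexField.Normc.normc0 expr0n.
have S (F : 'I_n -> R) : \sum_k F k * weight U x k = F i.
  rewrite (bigD1 i)//= wx eqxx mulr1 big1 ?addr0// => k /negPf ki.
  by rewrite wx ki mulr0.
exists x.
  apply/eqP; rewrite -(@eqrXn2 _ 2) ?norm2_ge0// (norm2_weight UU) expr1n.
  rewrite -[X in _ == X](S (fun=> 1)).
  by apply/eqP/eq_bigr => k _; rewrite mul1r.
apply/eqP; rewrite -subr_eq0; apply/eqP/norm2_eq0/eqP.
by rewrite -sqrf_eq0 (norm2_shift UU UX) S subrr expr0n.
Qed.

(** * Comparison of ordered eigenvalues through quadratic forms *)

Lemma eigenval_le n (X : 'M[R[i]]_n) (j k : 'I_n) :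
  (j <= k)%N -> eigenval X j <= eigenval X k.
Proof.
by apply: (sorted_leq_nth le_trans lexx 0); rewrite ?inE ?size_eigenvals//;
  exact: sort_le_sorted.
Qed.

Lemma rdot_specnorm n (M : 'M[R[i]]_n) x :
  `|rdot x (M *m x)| <= specnorm M * norm2 x ^+ 2.
Proof.
apply: le_trans (rdot_le _ _) _.
by rewrite mulrC expr2 mulrA ler_wpM2r ?norm2_ge0// specnormP.
Qed.

Lemma rdot_residual n (a : R) (x y : 'cV[R[i]]_n) :
  rdot x (y - a%:C%C *: x) = rdot x y - a * norm2 x ^+ 2.
Proof. by rewrite rdotBr rdotZr norm2_sqr. Qed.

(* A nonzero vector orthogonal to the top eigenvectors of [Y] and to the bottom
   ones of [X] exists because these are only [n - 1] conditions. *)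
Lemma eigenval_monotone n (X Y : 'M[R[i]]_n) (i : 'I_n) (c : R) :
  X \is hermsymmx -> Y \is hermsymmx ->
  (forall x, rdot x (X *m x) <= rdot x (Y *m x) + c * norm2 x ^+ 2) ->
  eigenval X i <= eigenval Y i + c.
Proof.
move=> /herm_diag[U UU UX] /herm_diag[V VV VY] XY.
(* The orthogonality conditions are the rows of [N]. Row [i] is left zero, so [N] is singular and
   has a nonzero kernel vector. *)
pose N : 'M[R[i]]_n := \matrix_(k, l)
  (if (k < i)%N then U k l else if (i < k)%N then V k l else 0).
have [v v0 Nv] : exists2 v : 'rV_n, v != 0 & v *m N^T = 0.
  apply/det0P; rewrite det_tr (expand_det_row _ i) big1// => l _.
  by rewrite mxE ltnn mul0r.
pose x := v^T; have x0 : 0 < norm2 x by rewrite norm2_gt0// trmx_eq0.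
have Nx : N *m x = 0 by rewrite -[N]trmxK -trmx_mul Nv trmx0.
have Ux (k : 'I_n) : (k < i)%N -> weight U x k = 0.
  move=> ki; have : (N *m x) k 0 = 0 by rewrite Nx mxE.
  rewrite /weight !mxE; under eq_bigr do rewrite mxE ki.
  by move=> ->; rewrite ComplexField.Normc.normc0 expr0n.
have Vx (k : 'I_n) : (i < k)%N -> weight V x k = 0.
  move=> ki; have : (N *m x) k 0 = 0 by rewrite Nx mxE.
  rewrite /weight !mxE; under eq_bigr do rewrite mxE ltnNge (ltnW ki) /= ki.
  by move=> ->; rewrite ComplexField.Normc.normc0 expr0n.
have hX : 0 <= rdot x (X *m x - (eigenval X i)%:C%C *: x).
  rewrite (rdot_shift UU UX); apply: sumr_ge0 => k _.
  have [/Ux->|ik] := ltnP k i; first by rewrite mulr0.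
  by rewrite mulr_ge0 ?weight_ge0// subr_ge0 eigenval_le.
have hY : rdot x (Y *m x - (eigenval Y i)%:C%C *: x) <= 0.
  rewrite (rdot_shift VV VY); apply: sumr_le0 => k _.
  have [ik|/Vx->] := leqP k i; last by rewrite mulr0.
  by rewrite mulr_le0_ge0 ?weight_ge0// subr_le0 eigenval_le.
have x2 : 0 < norm2 x ^+ 2 by rewrite exprn_gt0.
rewrite rdot_residual subr_ge0 in hX; rewrite rdot_residual subr_le0 in hY.
rewrite -(ler_pM2r x2) mulrDl; apply: le_trans hX (le_trans (XY x) _).
by rewrite lerD2r.
Qed.

(** * Eigenvalues along the segment from [A] to [A + E] *)

(** The radius [e] may depend on [t], so a supremum argument replaces subdivision: the last point
    where the bound from 0 holds can only be 1. *)
Lemma locally_lipschitz_le (f : R -> R) (C : R) :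
  (forall t : R, 0 <= t <= 1 -> exists2 e : R, 0 < e &
     forall s : R, 0 <= s <= 1 -> `|s - t| < e -> `|f s - f t| <= C * `|s - t|) ->
  f 1 - f 0 <= C.
Proof.
move=> loc; pose S : classical_sets.set R :=
  fun t => 0 <= t <= 1 /\ f t - f 0 <= C * t.
have S0 : S 0 by rewrite /S lexx ler01 subrr mulr0.
have Sub : classical_sets.has_ubound S by exists 1 => t [/andP[]].
have T01 : 0 <= sup S <= 1.
  rewrite (ub_le_sup Sub S0) /=; apply: ge_sup; first by exists 0.
  by move=> t [/andP[]].
have [e e0 eP] := loc _ T01; set T := sup S in T01 eP *.
(* The supremum is attained: the local bound at [T] links it to a point of [S] just to its left. *)
have ST : S T.
  have [||t St tT] := @sup_adherent _ S e => //; first by split=> //; exists 0.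
  have tT' : t <= T := ub_le_sup Sub St.
  have [t01 ft] := St; split=> //.
  have tTe : `|t - T| < e.
    by rewrite ler0_norm ?subr_le0//; rewrite -/T in tT; lra.
  have := eP _ t01 tTe; rewrite [`|t - T|]ler0_norm ?subr_le0//.
  by rewrite ler_norml => /andP[h _]; lra.
have [T1 fT] := ST.
have [t1|t1] := eqVneq T 1; first by move: fT; rewrite t1 mulr1.
(* If [T < 1], the local bound at [T] puts this point to its right into [S], a contradiction. *)
pose s := Order.min 1 (T + e / 2).
have sT : T < s.
  rewrite lt_min; case/andP: T01 => _; rewrite le_eqVlt (negPf t1) /= => ->.
  lra.
have s1 : s <= 1 by rewrite ge_min lexx.
have se : s <= T + e / 2 by rewrite ge_min lexx orbT.
have s01 : 0 <= s <= 1 by rewrite s1 andbT; case/andP: T01 => *; lra.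
have sTe : `|s - T| < e by rewrite gtr0_norm ?subr_gt0//; lra.
have := eP _ s01 sTe; rewrite [`|s - T|]gtr0_norm ?subr_gt0//.
rewrite ler_norml => /andP[_ h].
have Ss : S s by split=> //; lra.
by have := ub_le_sup Sub Ss; rewrite -/T leNgt sT.
Qed.

Lemma hermDZ n (A E : 'M[R[i]]_n) (t : R) :
  A \is hermsymmx -> E \is hermsymmx -> A + t%:C%C *: E \is hermsymmx.
Proof.
move=> /hermP AH /hermP EH; apply: hermE; apply/matrixP => k l.
have := congr1 (fun N : 'M_n => N k l) AH.
have := congr1 (fun N : 'M_n => N k l) EH.
rewrite !mxE => EE AA; rewrite rmorphD rmorphM.
by congr (_ + _ * _) => //; exact: conjc_real.
Qed.

(** Weyl's inequality: the quadratic forms at [s] and [t] differ by at most [|s - t| * specnorm E]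
    on unit vectors, and monotonicity applies in both directions. *)
Lemma eigenval_lipschitz n (A E : 'M[R[i]]_n) (t s : R) (i : 'I_n) :
  A \is hermsymmx -> E \is hermsymmx ->
  `|eigenval (A + s%:C%C *: E) i - eigenval (A + t%:C%C *: E) i|
    <= `|s - t| * specnorm E.
Proof.
move=> AH EH; have half u v : eigenval (A + v%:C%C *: E) i <=
    eigenval (A + u%:C%C *: E) i + `|v - u| * specnorm E.
  apply: eigenval_monotone (hermDZ v AH EH) (hermDZ u AH EH) _ => x.
  have -> : A + v%:C%C *: E = A + u%:C%C *: E + (v - u)%:C%C *: E.
    by rewrite rmorphB scalerBl -addrA; congr (A + _); rewrite addrC subrK.
  rewrite mulmxDl rdotDr lerD2l -scalemxAl rdotZr.
  apply: le_trans (ler_norm _) _.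
  by rewrite normrM -mulrA ler_wpM2l// rdot_specnorm.
rewrite ler_norml lerBlDl half andbT lerNl opprB lerBlDl distrC; exact: half.
Qed.

Lemma eigenval_path n (A E : 'M[R[i]]_n) (i : 'I_n) (B : R) :
  A \is hermsymmx -> E \is hermsymmx ->
  (forall (t : R) x, 0 <= t <= 1 -> norm2 x = 1 ->
    (A + t%:C%C *: E) *m x = (eigenval (A + t%:C%C *: E) i)%:C%C *: x ->
    `|rdot x (E *m x)| <= B) ->
  `|eigenval A i - eigenval (A + E) i| <= B.
Proof.
move=> AH EH HB; pose M (t : R) := A + t%:C%C *: E.
have MH t : M t \is hermsymmx by exact: hermDZ.
have M0 : M 0 = A by rewrite /M rmorph0 scale0r addr0.
have M1 : M 1 = A + E by rewrite /M rmorph1 scale1r.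
have ML t s : M s = M t + (s - t)%:C%C *: E.
  by rewrite /M rmorphB scalerBl -addrA; congr (A + _); rewrite addrC subrK.
have fW t s := eigenval_lipschitz t s i AH EH.
rewrite -[A in eigenval A _]M0 -M1.
change (forall t s,
  `|eigenval (M s) i - eigenval (M t) i| <= `|s - t| * specnorm E) in fW.
change (forall (t : R) x, 0 <= t <= 1 -> norm2 x = 1 ->
    M t *m x = (eigenval (M t) i)%:C%C *: x -> `|rdot x (E *m x)| <= B) in HB.
clearbody M; set e := specnorm E in fW *; pose f t := eigenval (M t) i.
have e0 : 0 <= e := specnorm_ge0 E.
(* [K] depends on [t] through the spectral gap at [f t], but not on [s]. *)
have loc t : exists2 K : R, 0 <= K & forall s : R, 0 <= s <= 1 ->
    `|f s - f t| <= `|s - t| * (B + K * `|s - t|).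
  have [g g0 gP] := herm_rdot_shift_le (f t) (MH t).
  (* The residual of a unit eigenvector of [M s] at [M t] is at most [2 * e * |s - t|]: one [e] from
     the eigenvalue drift, one from [E *m x]. Its square is divided by the gap. *)
  exists (4 * e ^+ 2 / g).
    by rewrite divr_ge0 ?(ltW g0)// mulr_ge0 ?sqr_ge0.
  move=> s s01; have [x x1 xe] := eigenvec i (MH s).
  have hB := HB s x s01 x1 xe; have := gP x.
  have xs : M t *m x - (f t)%:C%C *: x =
      (f s - f t)%:C%C *: x - (s - t)%:C%C *: (E *m x).
    have -> : M t = M s - (s - t)%:C%C *: E by rewrite (ML t s) addrK.
    by rewrite mulmxBl xe -scalemxAl addrAC -scalerBl -rmorphB.
  rewrite xs; set r := _ - _ => hr.
  have nr : norm2 r <= 2 * e * `|s - t|.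
    apply: le_trans (norm2B _ _) _; rewrite !norm2Z x1 mulr1.
    have := specnormP E x; rewrite x1 mulr1 -/e => h.
    have := ler_wpM2l (normr_ge0 (s - t)) h.
    have : `|f s - f t| <= `|s - t| * e := fW t s; lra.
  have rr : f s - f t = rdot x r + (s - t) * rdot x (E *m x).
    by rewrite rdotBr !rdotZr -(norm2_sqr x) x1 expr1n mulr1 subrK.
  have h1 : `|rdot x r| <= 4 * e ^+ 2 / g * `|s - t| ^+ 2.
    rewrite mulrAC ler_pdivlMr// mulrC; apply: le_trans hr _.
    have : norm2 r ^+ 2 <= (2 * e * `|s - t|) ^+ 2.
      by rewrite ler_pXn2r ?nnegrE ?norm2_ge0 ?mulr_ge0.
    by rewrite !exprMn -natrX.
  rewrite rr; apply: le_trans (ler_normD _ _) _.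
  rewrite normrM mulrDr addrC lerD ?ler_wpM2l//.
  by rewrite mulrCA -expr2.
(* Any slack above [B] absorbs the quadratic term for [s] close to [t]. *)
suff key (C : R) : B < C -> `|f 1 - f 0| <= C.
  by rewrite distrC; apply/ler_addgt0Pr => d d0; apply: key; lra.
move=> BC.
have locC t : exists2 d : R, 0 < d &
    forall s : R, 0 <= s <= 1 -> `|s - t| < d -> `|f s - f t| <= C * `|s - t|.
  have [K K0 KP] := loc t; have K1 : 0 < K + 1 by rewrite ltr_wpDl.
  (* Within this radius [K * |s - t| <= C - B]; adding 1 covers [K = 0]. *)
  exists ((C - B) / (K + 1)); first by rewrite divr_gt0 ?subr_gt0.
  move=> s s01; rewrite ltr_pdivlMr// => st.
  apply: le_trans (KP _ s01) _; rewrite mulrC ler_wpM2r//.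
  have := normr_ge0 (s - t); lra.
have up : f 1 - f 0 <= C by apply: locally_lipschitz_le => t _; exact: locC.
(* The Lipschitz lemma is one-sided; applying it to [- f] gives the other sign. *)
have down : - f 1 - - f 0 <= C.
  apply: (@locally_lipschitz_le (fun t => - f t)) => t _.
  have [d d0 dP] := locC t; exists d => // s s01 st.
  by rewrite -opprD normrN; exact: dP.
by rewrite ler_norml up andbT lerNl opprB; move: down; rewrite opprK addrC.
Qed.

(** * Estimates for block matrices *)

Lemma rdot_col_mx m n (x1 y1 : 'cV[R[i]]_m) (x2 y2 : 'cV[R[i]]_n) :
  rdot (col_mx x1 x2) (col_mx y1 y2) = rdot x1 y1 + rdot x2 y2.
Proof.
by rewrite !rdotE big_split_ord; congr (_ + _); apply: eq_bigr => k _;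
  rewrite ?col_mxEu ?col_mxEd.
Qed.

Lemma norm2_col_mx m n (x1 : 'cV[R[i]]_m) (x2 : 'cV[R[i]]_n) :
  norm2 (col_mx x1 x2) ^+ 2 = norm2 x1 ^+ 2 + norm2 x2 ^+ 2.
Proof. by rewrite !norm2_sqr rdot_col_mx. Qed.

(** Padding [x] with a zero upper block preserves its norm, and [E22 *m x] is the lower block of the
    image. *)
Lemma specnorm_drsubmx m n (E11 : 'M[R[i]]_m) E12 E21 (E22 : 'M[R[i]]_n) x :
  norm2 (E22 *m x) <= specnorm (block_mx E11 E12 E21 E22) * norm2 x.
Proof.
have := specnormP (block_mx E11 E12 E21 E22) (col_mx 0 x).
have -> : norm2 (col_mx (0 : 'cV_m) x) = norm2 x.
  apply/eqP; rewrite -(@eqrXn2 _ 2) ?norm2_ge0// norm2_col_mx.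
  by rewrite norm2_0 expr0n add0r.
rewrite mul_block_col !mulmx0 !add0r; apply: le_trans.
rewrite -(@ler_pXn2r _ 2) ?nnegrE ?norm2_ge0// norm2_col_mx.
by rewrite lerDr sqr_ge0.
Qed.

Lemma herm_block m n (X11 : 'M[R[i]]_m) (X21 : 'M[R[i]]_(n, m))
    (X22 : 'M[R[i]]_n) :
  X11 \is hermsymmx -> X22 \is hermsymmx ->
  block_mx X11 (X21^t*) X21 X22 \is hermsymmx.
Proof.
move=> /hermP h1 /hermP h2; apply: hermE.
by rewrite tr_block_mx map_block_mx trmxCK h1 h2.
Qed.

(** The two off-diagonal terms have the same real part by adjunction, whence the factor 2. *)
Lemma rdot_block_le m n (E11 : 'M[R[i]]_m) (E21 : 'M[R[i]]_(n, m))
    (E22 : 'M[R[i]]_n) x1 x2 :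
  `|rdot (col_mx x1 x2) (block_mx E11 (E21^t*) E21 E22 *m col_mx x1 x2)|
    <= specnorm E11 * norm2 x1 ^+ 2 + 2 * specnorm E21 * (norm2 x1 * norm2 x2)
       + specnorm E22 * norm2 x2 ^+ 2.
Proof.
rewrite mul_block_col rdot_col_mx !rdotDr (rdotC x1 (_ *m x2)) rdot_adjoint.
have h1 := rdot_specnorm E11 x1; have h2 := rdot_specnorm E22 x2.
have h3 : `|rdot x2 (E21 *m x1)| <= specnorm E21 * (norm2 x1 * norm2 x2).
  apply: le_trans (rdot_le _ _) _.
  by rewrite mulrC mulrA ler_wpM2r ?norm2_ge0// specnormP.
rewrite addrA -(addrA (rdot x1 _)) -mulr2n.
apply: le_trans (ler_normD _ _) (lerD _ h2).
apply: le_trans (ler_normD _ _) (lerD h1 _).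
by rewrite normrMn -[_ *+ 2]mulr_natl -mulrA ler_wpM2l.
Qed.

(** The second block row expresses [(A22 - a) x2] through [(mu - a) x2], [t E22 x2] and a multiple
    of [x1]. The first two cost [specnorm E] each, hence the [2 * specnorm E] taken from the
    distance. Measuring from the fixed [a] rather than from [mu] makes the bound uniform in [t]. *)
Lemma eigenvec_block_le m n (A11 E11 : 'M[R[i]]_m)
    (A21 E21 : 'M[R[i]]_(n.+1, m))
    (A22 E22 : 'M[R[i]]_n.+1) (a mu t : R) x1 x2 :
  let E := block_mx E11 (E21^t*) E21 E22 in
  A22 \is hermsymmx -> 0 <= t <= 1 -> `|mu - a| <= t * specnorm E ->
  2 * specnorm E <= spectrum_dist A22 a ->
  (block_mx A11 (A21^t*) A21 A22 + t%:C%C *: E) *m col_mx x1 x2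
    = mu%:C%C *: col_mx x1 x2 ->
  (spectrum_dist A22 a - 2 * specnorm E) * norm2 x2
    <= (specnorm A21 + specnorm E21) * norm2 x1.
Proof.
move=> E A22H /andP[t0 t1] mua gap.
rewrite mulmxDl -scalemxAl !mul_block_col !scale_col_mx add_col_mx.
move=> /eq_col_mx[_]; set L := _ + _ => eL.
have E0 : 0 <= specnorm E by exact: specnorm_ge0.
have d0 : 0 <= spectrum_dist A22 a by apply: le_trans gap; rewrite mulr_ge0.
have lb := norm2_shift_ge x2 A22H d0.
have r2 : A22 *m x2 - a%:C%C *: x2 = (mu - a)%:C%C *: x2
    - t%:C%C *: (E22 *m x2) - (A21 *m x1 + t%:C%C *: (E21 *m x1)).
  rewrite rmorphB scalerBl -eL /L scalerDr.
  move: (A21 *m x1) (A22 *m x2) (_ *: (E21 *m x1)) (_ *: (E22 *m x2)) (_ *: x2).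
  move=> p q r s u; apply/matrixP => k l; rewrite !mxE; ring.
have ub : norm2 (A22 *m x2 - a%:C%C *: x2) <= specnorm E * norm2 x2
    + specnorm E * norm2 x2 + (specnorm A21 + specnorm E21) * norm2 x1.
  have tZ p (z : 'cV[R[i]]_p) : norm2 (t%:C%C *: z) <= norm2 z.
    by rewrite norm2Z ger0_norm// ler_piMl ?norm2_ge0.
  rewrite r2; apply: le_trans (norm2B _ _) (lerD _ _).
    apply: le_trans (norm2B _ _) (lerD _ _).
      rewrite norm2Z ler_wpM2r ?norm2_ge0//; apply: le_trans mua _.
      by rewrite ler_piMl.
    exact: le_trans (tZ _ _) (specnorm_drsubmx _ _ _ _ _).
  rewrite mulrDl; apply: le_trans (norm2D _ _) (lerD (specnormP _ _) _).
  exact: le_trans (tZ _ _) (specnormP _ _).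
rewrite mulrBl lerBlDl -[2 * _ * _]mulrA [2 * _]mulr_natl mulr2n.
exact: le_trans lb ub.
Qed.

End HermitianPerturbation.

Theorem theorem1 (R : realType) (m n : nat)
    (A11 E11 : 'M[R[i]]_m) (A21 E21 : 'M[R[i]]_(n.+1, m))
    (A22 E22 : 'M[R[i]]_n.+1)
    (hA11 : A11 \is hermsymmx) (hA22 : A22 \is hermsymmx)
    (hE11 : E11 \is hermsymmx) (hE22 : E22 \is hermsymmx) :
  let A : 'M[R[i]]_(m + n.+1) := block_mx A11 (A21^t*) A21 A22 in
  let E : 'M[R[i]]_(m + n.+1) := block_mx E11 (E21^t*) E21 E22 in
  forall i : 'I_(m + n.+1),
  let lambda := eigenval A i in
  let lambda_hat := eigenval (A + E) i in
  let tau := (specnorm A21 + specnorm E21)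
               / (spectrum_dist A22 lambda - 2 * specnorm E) in
  0 < tau ->
  `|lambda - lambda_hat|
    <= specnorm E11 + 2 * specnorm E21 * tau + specnorm E22 * tau ^+ 2.
Proof.
move=> A E i lambda lambda_hat tau tau0.
have AH : A \is hermsymmx := herm_block A21 hA11 hA22.
have EH : E \is hermsymmx := herm_block E21 hE11 hE22.
have num0 : 0 <= specnorm A21 + specnorm E21 by rewrite addr_ge0 ?specnorm_ge0.
(* The numerator is nonnegative, so a positive quotient forces a positive denominator; a zero
   denominator would give [tau = 0], since the inverse of 0 is 0. *)
have den0 : 0 < spectrum_dist A22 lambda - 2 * specnorm E.
  rewrite ltNge; apply: contraL tau0 => den; rewrite -leNgt.
  by rewrite mulr_ge0_le0 ?invr_le0.
apply: (eigenval_path AH EH) => t x t01 x1 xE.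
(* Drift of the eigenvalue from its value [lambda] at parameter 0, at most [t * specnorm E]. *)
have lip := eigenval_lipschitz 0 t i AH EH.
rewrite rmorph0 scale0r addr0 subr0 [`|t|]ger0_norm in lip; last first.
  by case/andP: t01.
move: x1 xE; rewrite -[x]vsubmxK; move: (usubmx x) (dsubmx x) => x1 x2 nx xE.
have := eigenvec_block_le hA22 t01 lip _ xE.
rewrite -subr_ge0 => /(_ (ltW den0)).
(* Dividing by the positive denominator gives [norm2 x2 <= tau * norm2 x1]; with [norm2 x1 <= 1] the
   three block terms are bounded separately. *)
rewrite mulrC -ler_pdivlMr// mulrAC -/tau => x2tau.
apply: le_trans (rdot_block_le _ _ _ _ _) _.
have n1 := norm2_ge0 x1; have n2 := norm2_ge0 x2.
have x1le : norm2 x1 <= 1.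
  rewrite -(@ler_pXn2r _ 2) ?nnegrE// expr1n.
  by rewrite -(expr1n _ 2) -nx norm2_col_mx lerDl sqr_ge0.
have x2le : norm2 x2 <= tau.
  by apply: le_trans x2tau _; rewrite ler_piMr// ltW.
apply: lerD; first apply: lerD.
- by rewrite ler_piMr ?specnorm_ge0// exprn_ile1.
- rewrite ler_wpM2l ?mulr_ge0 ?specnorm_ge0//.
  by apply: le_trans x2le; rewrite ler_piMl.
- by rewrite ler_wpM2l ?specnorm_ge0// ler_pXn2r ?nnegrE// ltW.
Qed.
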